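(* Let $S$ be a complete hyperbolic surface of finite type, that is, $S = \mathbb{H}^2/\Gamma$ (up to isometry) for a finitely generated Fuchsian group $\Gamma$. Let $A(S)$ be the set of all angles of intersection between pairs of closed geodesics on $S$. Then only finitely many elements of $A(S)$ are rational multiples of $\pi$; that is, the set $A(S) \cap \mathbb{Q}\pi$ is finite.
   Context: $\mathbb{H}^2$ is the hyperbolic plane (upper half-plane model), on which $\mathrm{PSL}(2,\mathbb{R})$ acts by orientation-preserving isometries. A Fuchsian group is a discrete subgroup $\Gamma$ of $\mathrm{PSL}(2,\mathbb{R})$; elliptic elements are allowed (for example, the modular surface $\mathbb{H}^2/\mathrm{PSL}(2,\mathbb{Z})$ is included). A closed geodesic on $S=\mathbb{H}^2/\Gamma$ is the projection to $S$ of the axis of a hyperbolic element of $\Gamma$ (the axis is the geodesic of $\mathbb{H}^2$ joining the two fixed points of the element on $\partial\mathbb{H}^2 = \mathbb{R}\cup\{\infty\}$). Angles: let $\gamma$ and $\delta$ be closed geodesics on $S$ that intersect at a point $p$. The angle of intersection $\theta(\gamma,\delta,p)$ is measured in the counterclockwise direction from $\gamma$ to $\delta$ at $p$, so that $\theta(\gamma,\delta,p) = \pi - \theta(\delta,\gamma,p)$. Equivalently, choose hyperbolic elements $M_\gamma, M_\delta\in\Gamma$ representing $\gamma$ and $\delta$ whose axes in $\mathbb{H}^2$ cross at a lift $\tilde p$ of $p$; then $\theta(\gamma,\delta,p)\in(0,\pi)$ is the counterclockwise angle at $\tilde p$ from the axis of $M_\gamma$ to the axis of $M_\delta$. $A(S)$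 is the set of all values $\theta(\gamma,\delta,p)$, over all pairs of closed geodesics $\gamma,\delta$ on $S$ and all their intersection points $p$, taken without multiplicity (an angle occurring at several intersections is counted once). *)

(* Defs.v *)
From HB Require Import structures.
From mathcomp Require Import all_boot all_order all_algebra.
From mathcomp Require Import all_classical all_reals all_analysis.
From mathcomp Require Import complex.

Set Implicit Arguments.
Unset Strict Implicit.
Unset Printing Implicit Defensive.

Import Order.TTheory GRing.Theory Num.Theory.
Import numFieldNormedType.Exports.

Local Open Scope classical_set_scope.
Local Open Scope ring_scope.
Local Open Scope complex_scope.

(* A subgroup of PSL(2,R) = SL(2,R)/{1,-1} is encoded by its full preimage in
   SL(2,R), i.e. by a subgroup of SL(2,R) stable under M |-> - M. *)
Definition psl2_subgroup (R : realType) (G : set 'M[R]_2) : Prop :=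
  [/\ forall M, G M -> \det M = 1,
      G 1%:M,
      forall M, G M -> G (- M),
      forall M N, G M -> G N -> G (M *m N)
    & forall M, G M -> G (invmx M)].

(* SL(2,R) -> PSL(2,R) is a covering map, so a subgroup of PSL(2,R) is discrete
   iff its preimage is a discrete subset of SL(2,R), hence of 'M[R]_2. *)
Definition fuchsian (R : realType) (G : set 'M[R]_2) : Prop :=
  psl2_subgroup G /\ G `<=` isolated G.

(* Generation is meant in PSL(2,R): -1 belongs to every psl2_subgroup. *)
Definition finitely_generated (R : realType) (G : set 'M[R]_2) : Prop :=
  exists gens : seq 'M[R]_2,
    [set` gens] `<=` G /\
    forall H : set 'M[R]_2, psl2_subgroup H -> [set` gens] `<=` H -> G `<=` H.

Definition upper_half_plane (R : realType) : set R[i] := [set z | 0 < complex.Im z].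

Definition mobius (R : realType) (M : 'M[R]_2) (z : R[i]) : R[i] :=
  ((M 0 0)%:C * z + (M 0 1)%:C) / ((M 1 0)%:C * z + (M 1 1)%:C).

(* The action on the boundary of the hyperbolic plane; None is infinity. *)
Definition mobius_bd (R : realType) (M : 'M[R]_2) (x : option R) : option R :=
  match x with
  | Some a => if M 1 0 * a + M 1 1 == 0 then None
              else Some ((M 0 0 * a + M 0 1) / (M 1 0 * a + M 1 1))
  | None => if M 1 0 == 0 then None else Some (M 0 0 / M 1 0)
  end.

(* Meaningful for distinct endpoints only. *)
Definition geodesic (R : realType) (x y : option R) : set R[i] :=
  @upper_half_plane R `&`
  match x, y with
  | Some a, Some b =>
      [set z | `|z - ((a + b) / 2)%:C| = (`|a - b| / 2)%:C]
  | Some a, None | None, Some a => [set z | complex.Re z = a]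
  | None, None => set0
  end.

Definition hyperbolic (R : realType) (M : 'M[R]_2) : Prop := 2 < `|\tr M|.

Definition axis (R : realType) (M : 'M[R]_2) : set R[i] :=
  [set z | exists x y : option R,
     [/\ x != y, mobius_bd M x = x, mobius_bd M y = y & geodesic x y z]].

(* The point of the quotient by G lying below z, as a G-orbit. *)
Definition proj (R : realType) (G : set 'M[R]_2) (z : R[i]) : set R[i] :=
  [set mobius M z | M in G].

(* gamma is the closed geodesic of the quotient represented by M. *)
Definition represents (R : realType) (G : set 'M[R]_2) (M : 'M[R]_2)
    (gamma : set (set R[i])) : Prop :=
  [/\ G M, hyperbolic M & gamma = proj G @` axis M].

Definition closed_geodesic (R : realType) (G : set 'M[R]_2)
    (gamma : set (set R[i])) : Prop :=
  exists M, represents G M gamma.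

(* u is the velocity at z of a curve contained in L. *)
Definition tangent (R : realType) (L : set R[i]) (z u : R[i]) : Prop :=
  u != 0 /\
  exists c : R -> R[i],
    [/\ forall t, L (c t), c 0 = z,
        is_derive (0 : R) (1 : R) (fun t => complex.Re (c t)) (complex.Re u)
      & is_derive (0 : R) (1 : R) (fun t => complex.Im (c t)) (complex.Im u)].

(* The half-plane model is conformal, so hyperbolic angles are Euclidean ones:
   theta is the counterclockwise angle from L1 to L2 at z when rotating a
   tangent vector of L1 by theta yields a tangent vector of L2.  As the lines
   are unoriented, theta is unique in ]0, pi[, and it exists only if L1 and L2
   cross at z. *)
Definition ccw_angle (R : realType) (L1 L2 : set R[i]) (z : R[i]) (theta : R)
    : Prop :=
  0 < theta < pi /\
  exists u, tangent L1 z u /\ tangent L2 z ((cos theta +i* sin theta) * u).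

(* theta is an angle from gamma to delta at the point p of the quotient; there
   are several when gamma or delta passes through p more than once. *)
Definition intersection_angle (R : realType) (G : set 'M[R]_2)
    (gamma delta : set (set R[i])) (p : set R[i]) (theta : R) : Prop :=
  exists M N z,
    [/\ represents G M gamma, represents G N delta, p = proj G z,
        axis M z /\ axis N z & ccw_angle (axis M) (axis N) z theta].

Definition angle_set (R : realType) (G : set 'M[R]_2) : set R :=
  [set theta | exists gamma delta p,
     [/\ closed_geodesic G gamma, closed_geodesic G delta,
         gamma p, delta p & intersection_angle G gamma delta p theta]].

(* Main.v *)
Require Import Defs.
From HB Require Import structures.
From mathcomp Require Import all_boot all_order all_algebra.
From mathcomp Require Import all_classical all_reals all_analysis.
From mathcomp Require Import all_field perm complex ring lra.

Set Implicit Arguments.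
Unset Strict Implicit.
Unset Printing Implicit Defensive.

Import Order.TTheory GRing.Theory Num.Theory.
Import numFieldNormedType.Exports.

Local Open Scope classical_set_scope.
Local Open Scope ring_scope.

(* Let K be the field generated by the entries of a finite set of generators.
   If the axes of hyperbolic M, N in G cross at angle t, then cos^2 t is a
   rational function of the entries of M and N, so cos 2t lies in K and
   e^(2it) has degree at most 2 over K.  In a finitely generated extension of
   Q, an algebraic number of bounded degree over K has bounded degree over Q
   (adjoining a transcendental does not change its degree, adjoining an
   algebraic element divides it by at most a constant).  When t is a rational
   multiple of pi, e^(2it) is a root of unity of some order n, of degree
   totient n over Q; so n divides a fixed integer, and finitely many t remain. *)

(** * Algebraic elements of bounded degree over a subfield *)

Lemma rpred_det (R : comNzRingType) (S : subringClosed R) (n : nat) (A : 'M[R]_n) :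
  (forall i j, A i j \in S) -> \det A \in S.
Proof.
move=> AS; rewrite /determinant; apply: rpred_sum => u _.
by apply: rpredM; [rewrite rpredX // rpredN rpred1|apply: rpred_prod].
Qed.

(** No irreducibility is asked of [p]: over a field this means degree at most [d], and failure for
    every [d] means transcendence. *)
Definition degree_le (C : fieldType) (S : {pred C}) (d : nat) (x : C) : Prop :=
  exists p, [/\ p \is a polyOver S, p != 0, (size p <= d.+1)%N & root p x].

(* Cayley-Hamilton trick: x is an eigenvalue of the matrix of multiplication by
   x on the S-module spanned by the v k. *)
Lemma finite_module_root (C : fieldType) (S : subringClosed C) (I : finType)
    (v : I -> C) (x : C) (k0 : I) :
  v k0 != 0 ->
  (forall k, exists s : I -> C,
     (forall l, s l \in S) /\ x * v k = \sum_l s l * v l) ->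
  degree_le S #|I| x.
Proof.
move=> vk0 /choice[s sP].
(* Eigenvectors are rows here, so column j holds the coefficients of [x * v j]. *)
pose A : 'M[C]_#|I| := \matrix_(i, j) s (enum_val j) (enum_val i).
exists (char_poly A); split.
- apply: rpred_det => i j; rewrite !mxE; apply: rpredB.
    by rewrite rpredMn // polyOverX.
  by rewrite polyOverC; have [] := sP (enum_val j).
- by rewrite -size_poly_eq0 size_char_poly.
- by rewrite size_char_poly.
rewrite -eigenvalue_root_char; apply/eigenvalueP.
exists (\row_i v (enum_val i)).
  apply/rowP => j; rewrite !mxE; have [_ ->] := sP (enum_val j).
  rewrite (reindex _ (onW_bij _ (@enum_val_bij I))) /=; apply: eq_bigr => i _.
  by rewrite !mxE mulrC.
apply/eqP => /rowP/(_ (enum_rank k0)); rewrite !mxE enum_rankK.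
exact/eqP.
Qed.

(** Euclidean division of [r] by [p], one coefficient of [r] at a time, so that all coefficients
    visibly stay in [S]. *)
Lemma reduce_horner (C : fieldType) (S : divringClosed C) (a : C) (p r : {poly C}) :
  p \is a polyOver S -> p != 0 -> root p a -> r \is a polyOver S ->
  exists r', [/\ r' \is a polyOver S, (size r' < size p)%N & r'.[a] = r.[a]].
Proof.
move=> pS p0 pa; elim/poly_ind: r => [_|r c IH rcS].
  by exists 0; rewrite rpred0 size_poly0 size_poly_gt0.
have cS : c \in S.
  by have /polyOverP/(_ 0) := rcS; rewrite coefD coefMX coefC add0r.
have rS : r \is a polyOver S.
  by apply/polyOverP => i; have /polyOverP/(_ i.+1) := rcS;
    rewrite coefD coefMX coefC addr0.
have {IH} [r' [r'S r'p r'a]] := IH rS.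
have sp : (0 < size p)%N by rewrite size_poly_gt0.
set e := (size p).-1; have Ee : e.+1 = size p by rewrite prednK.
pose t := r' * 'X + c%:P.
have tS : t \is a polyOver S by rewrite rpredD ?rpredM ?polyOverX ?polyOverC.
have st : (size t <= e.+1)%N.
  by rewrite size_MXaddC; case: ifP => // _; rewrite -Ee in r'p.
(* The subtracted multiple of [p] cancels the only coefficient of [t] that can be in degree [e], the
   degree of [p]. *)
exists (t - (t`_e / lead_coef p) *: p); split.
- rewrite rpredB // polyOverZ // rpred_div //; last exact: (polyOverP pS).
  exact: (polyOverP tS).
- rewrite -Ee ltnS; apply/leq_sizeP => j; rewrite leq_eqVlt => /orP[/eqP<-|ej].
    rewrite coefB coefZ /lead_coef -/e divfK ?subrr //.
    by rewrite -/(lead_coef p) lead_coef_eq0.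
  have pj : p`_j = 0 by apply: nth_default; rewrite -Ee.
  by rewrite coefB coefZ pj mulr0 subr0 (nth_default 0 (leq_trans st ej)).
- by rewrite !hornerE (rootP pa) r'a; ring.
Qed.

(** The products a^i x^j, with i and j below the degrees of [p] and [P], span an [S]-module stable
    under multiplication by [x]. As [P] is monic with coefficients in S[a], no division occurs. *)
Lemma degree_le_tower_monic (C : fieldType) (S : divringClosed C) (e d : nat)
    (a x : C) (P : {poly C}) :
  degree_le S e a -> P \is monic -> (size P <= d.+1)%N -> root P x ->
  (forall j, exists r, r \is a polyOver S /\ P`_j = r.[a]) ->
  degree_le S (e * d) x.
Proof.
move=> [p [pS p0 sp pa]] mP sP Px /choice[r rP].
have p1 := root_size_gt1 p0 pa.
have P1 := root_size_gt1 (monic_neq0 mP) Px.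
set e' := (size p).-1; set d' := (size P).-1.
have Ee : e'.+1 = size p by rewrite prednK // ltnW.
have Ed : d'.+1 = size P by rewrite prednK // ltnW.
have e0 : (0 < e')%N by rewrite -ltnS Ee.
have d0 : (0 < d')%N by rewrite -ltnS Ed.
pose v (k : 'I_e' * 'I_d') := a ^+ k.1 * x ^+ k.2.
suff [q [qS q0 sq qx]] : degree_le S #|{: 'I_e' * 'I_d'}| x.
  exists q; split=> //; apply: leq_trans sq _.
  by rewrite card_prod !card_ord ltnS leq_mul // -ltnS ?Ee ?Ed.
apply: (@finite_module_root _ _ _ v x (Ordinal e0, Ordinal d0)).
  by rewrite /v !expr0 mulr1 oner_eq0.
move=> [i j].
suff [T [TS Te ->]] : exists T : 'I_d' -> {poly C},
   [/\ forall k, T k \is a polyOver S, forall k, (size (T k) <= e')%N &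
       x * v (i, j) = \sum_k (T k).[a] * x ^+ k].
  exists (fun l : 'I_e' * 'I_d' => (T l.2)`_l.1).
  split=> [l|]; first exact: (polyOverP (TS _)).
  rewrite -(pair_big xpredT xpredT (fun (i : 'I_e') (j : 'I_d') =>
    (T j)`_i * (a ^+ i * x ^+ j))) /=.
  rewrite exchange_big; apply: eq_bigr => k _ /=.
  rewrite (horner_coef_wide _ (Te k)) mulr_suml.
  by apply: eq_bigr => l _; rewrite mulrA.
(* Multiplication by [x] shifts the exponent j, unless j is the last one; then [P] rewrites x^d' and
   reduction modulo [p] lowers the degrees in [a]. *)
have [jd|jd] := ltnP j.+1 d'.
  exists (fun k => if k == Ordinal jd then 'X^i else 0); split.
  - by move=> k; case: ifP => _; rewrite ?rpred0 ?polyOverXn.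
  - by move=> k; case: ifP => _; rewrite ?size_poly0 ?size_polyXn.
  - rewrite (bigD1 (Ordinal jd)) //= eqxx big1 ?addr0.
      by rewrite hornerXn /v /= exprS; ring.
    by move=> k /negPf->; rewrite horner0 mul0r.
have jd' : j.+1 = d' by apply/eqP; rewrite eqn_leq jd ltn_ord.
have /choice[T TP] : forall k : 'I_d', exists r',
    [/\ r' \is a polyOver S, (size r' < size p)%N & r'.[a] = (- ('X^i * r k)).[a]].
  move=> k; apply: reduce_horner => //; rewrite rpredN rpredM ?polyOverXn //.
  by have [] := rP k.
exists T; split=> [k|k|]; [by have [] := TP k|by have [] := TP k; rewrite -Ee|].
have xd : x ^+ d' = - \sum_(k < d') P`_k * x ^+ k.
  have /rootP := Px; rewrite horner_coef -Ed big_ord_recr /= => /eqP.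
  rewrite -[P`_d']/(lead_coef P) (monicP mP) mul1r addrC addr_eq0 => /eqP//.
have -> : x * v (i, j) = a ^+ i * x ^+ d'.
  by rewrite -[X in _ = _ * _ ^+ X]jd' exprS /v /=; ring.
rewrite xd mulrN mulr_sumr -sumrN; apply: eq_bigr => k _.
have [_ _ ->] := TP k; have [_ ->] := rP k.
by rewrite hornerN hornerM hornerXn; ring.
Qed.

(** Factors X of the annihilating polynomial are stripped until its constant term c is nonzero; then
    p(x) x = -c exhibits the inverse. For x = 0 the convention 0^-1 = 0 is used. *)
Lemma algebraic_inv_horner (C : fieldType) (S : divringClosed C) (e : nat) (x : C) :
  degree_le S e x -> exists2 r, r \is a polyOver S & x^-1 = r.[x].
Proof.
have [->|x0] := eqVneq x 0.
  by move=> _; exists 0; rewrite ?rpred0 // invr0 horner0.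
move=> [p [pS p0 _ px]]; elim/poly_ind: p => [|p c IH] in pS p0 px *.
  by rewrite eqxx in p0.
have cS : c \in S.
  by have /polyOverP/(_ 0) := pS; rewrite coefD coefMX coefC add0r.
have {}pS : p \is a polyOver S.
  by apply/polyOverP => i; have /polyOverP/(_ i.+1) := pS;
    rewrite coefD coefMX coefC addr0.
have [c0|c0] := eqVneq c 0.
  move: p0 px; rewrite c0 addr0 => p0; rewrite rootM rootX (negPf x0) orbF.
  by apply: IH => //; apply: contraNneq p0 => ->; rewrite mul0r.
exists ((- c^-1) *: p); first by rewrite polyOverZ // rpredN rpredV.
move: px => /rootP; rewrite !hornerE => px.
apply: (mulIf x0); rewrite mulVf // -mulrA.
have -> : p.[x] * x = - c by apply/eqP; rewrite -addr_eq0 px.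
by rewrite mulrNN mulVf.
Qed.

(** The leading coefficient of [P] lies in S[a], hence is algebraic, and its inverse is again a
    polynomial in [a]; dividing by it reduces to the monic case. *)
Lemma degree_le_tower (C : fieldType) (S : divringClosed C) (e d : nat)
    (a x : C) (P : {poly C}) :
  degree_le S e a -> P != 0 -> (size P <= d.+1)%N -> root P x ->
  (forall j, exists r, r \is a polyOver S /\ P`_j = r.[a]) ->
  degree_le S (e * d) x.
Proof.
move=> ha P0 sP Px hP.
have l0 : lead_coef P != 0 by rewrite lead_coef_eq0.
have [l [lS El]] := hP (size P).-1; rewrite -/(lead_coef P) in El.
have hl : degree_le S (e * 1) (lead_coef P).
  apply: (@degree_le_tower_monic _ S e 1 a _ ('X - (lead_coef P)%:P)) => //.
  - exact: monicXsubC.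
  - by rewrite size_XsubC.
  - by rewrite root_XsubC.
  move=> j; rewrite coefB coefX coefC.
  exists ((j == 1%N)%:R - if j == 0%N then l else 0); split.
    by rewrite rpredB ?rpred_nat //; case: ifP; rewrite ?rpred0.
  by rewrite hornerD hornerN hornerMn hornerC; case: ifP => _; rewrite ?El ?horner0.
have [r rS Er] := algebraic_inv_horner hl.
apply: (@degree_le_tower_monic _ S e d a x ((lead_coef P)^-1 *: P)) => //.
- by rewrite monicE lead_coefZ mulVf.
- by rewrite size_scale ?invr_eq0.
- by rewrite rootZ ?invr_eq0.
move=> j; have [s [sS Es]] := hP j.
exists ((r \Po l) * s); split; first by rewrite rpredM // polyOver_comp.
by rewrite coefZ Er hornerM horner_comp -El Es.
Qed.

(** * Adjoining one element, algebraic or transcendental *)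

Definition adjoin (C : fieldType) (S : divringClosed C) (a : C) : {pred C} :=
  fun y => `[< exists p q, [/\ p \is a polyOver S, q \is a polyOver S,
     q.[a] != 0 & y = p.[a] / q.[a]] >].

Lemma adjoin_divring_closed (C : fieldType) (S : divringClosed C) (a : C) :
  GRing.divring_closed (adjoin S a).
Proof.
split.
- by apply/asboolP; exists 1, 1; rewrite rpred1 hornerC oner_eq0 divr1.
- move=> x y /asboolP[p [q [pS qS q0 ->]]] /asboolP[p' [q' [p'S q'S q'0 ->]]].
  apply/asboolP; exists (p * q' - p' * q), (q * q'); rewrite !hornerE.
  split; rewrite ?mulf_neq0 // ?rpredB ?rpredM //.
  by field; rewrite q0 q'0.
- move=> x y /asboolP[p [q [pS qS q0 ->]]] /asboolP[p' [q' [p'S q'S q'0 ->]]].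
  apply/asboolP; have [p'0|p'0] := eqVneq p'.[a] 0.
    by exists 0, 1; rewrite rpred0 rpred1 !hornerE oner_eq0 p'0 mul0r invr0 mulr0.
  exists (p * q'), (q * p'); rewrite !hornerE.
  split; rewrite ?mulf_neq0 // ?rpredM //.
  by field; rewrite ?q0 ?p'0 ?q'0.
Qed.

HB.instance Definition _ (C : fieldType) (S : divringClosed C) (a : C) :=
  GRing.isDivringClosed.Build C (adjoin S a) (adjoin_divring_closed S a).

Lemma sub_adjoin (C : fieldType) (S : divringClosed C) (a : C) :
  {subset S <= adjoin S a}.
Proof.
move=> x xS; apply/asboolP; exists x%:P, 1.
by rewrite polyOverC rpred1 !hornerC oner_eq0 divr1.
Qed.

Lemma mem_adjoin (C : fieldType) (S : divringClosed C) (a : C) : a \in adjoin S a.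
Proof.
apply/asboolP; exists 'X, 1.
by rewrite polyOverX rpred1 hornerX hornerC oner_eq0 divr1.
Qed.

(** Turns a polynomial relation for [x] over S(a) into a polynomial relation between [a] and [x]
    over [S]. *)
Lemma adjoin_common_denominator (C : fieldType) (S : divringClosed C) (a : C)
    (c : nat -> C) (n : nat) :
  (forall i, c i \in adjoin S a) ->
  exists q (Q : nat -> {poly C}), [/\ q \is a polyOver S, q.[a] != 0,
    forall i, Q i \is a polyOver S &
    forall i, (i < n)%N -> c i * q.[a] = (Q i).[a]].
Proof.
move=> cS; elim: n => [|n [q [Q [qS q0 QS QE]]]].
  by exists 1, (fun=> 0); rewrite rpred1 hornerC oner_eq0; split=> // i; rewrite rpred0.
have /asboolP[p' [q' [p'S q'S q'0 Ec]]] := cS n.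
exists (q * q'), (fun i => if i == n then p' * q else Q i * q'); split.
- by rewrite rpredM.
- by rewrite hornerM mulf_neq0.
- by move=> i; case: ifP => _; rewrite rpredM.
move=> i; rewrite ltnS leq_eqVlt; case: eqP => [-> _|_ /= /QE Ei].
  by rewrite Ec !hornerM; field.
by rewrite !hornerM mulrA Ei.
Qed.

(* Over a transcendental a, a relation sum_k a^k R_k(x) = 0 with R_k over S
   forces R_k(x) = 0 for all k. *)
Lemma degree_le_transcendental (C : fieldType) (S : divringClosed C) (d f : nat)
    (a x : C) :
  (forall e, ~ degree_le S e a) -> degree_le S f x ->
  degree_le (adjoin S a) d x -> degree_le S d x.
Proof.
move=> aT xf [P [PS P0 sP /rootP Px]].
have [q [Q [qS q0 QS QE]]] := @adjoin_common_denominator C S a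
  (fun i => P`_i) d.+1 (polyOverP PS).
(* [R k] gathers the terms in a^k: q(a) P(x) is the sum of the a^k R_k(x). *)
pose R k := \poly_(j < d.+1) (Q j)`_k.
have RS k : R k \is a polyOver S.
  by apply: polyOver_poly => j _; apply: (polyOverP (QS j)).
have [//|nR] := pselect (degree_le S d x).
have Rx k : R k != 0 -> (R k).[x] != 0.
  move=> Rk; apply/negP => Rkx; apply: nR; exists (R k).
  by split=> //; apply: size_poly.
pose N := (\max_(j < d.+1) size (Q j))%N.
have sQ j : (j < d.+1)%N -> (size (Q j) <= N)%N.
  by move=> jd; apply: (leq_bigmax (Ordinal jd)).
pose W := \poly_(k < N) (R k).[x].
have Wa : root W a.
  apply/rootP; rewrite horner_poly.
  transitivity (q.[a] * P.[x]); last by rewrite Px mulr0.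
  rewrite (horner_coef_wide _ sP) mulr_sumr.
  under eq_bigr do rewrite horner_poly mulr_suml.
  rewrite exchange_big; apply: eq_bigr => j _ /=.
  rewrite mulrA [q.[a] * _]mulrC QE // (horner_coef_wide _ (sQ j (ltn_ord j))).
  by rewrite mulr_suml; apply: eq_bigr => k _; ring.
(* The leading coefficient of [P] gives a nonzero [Q m], whose own leading coefficient occurs in
   [R k]; hence R_k(x) is nonzero. *)
have W0 : W != 0.
  set m := (size P).-1.
  have md : (m < d.+1)%N by rewrite (leq_trans _ sP) // /m prednK // size_poly_gt0.
  have Qm : Q m != 0.
    apply/eqP => Qm; have /eqP := QE m md.
    rewrite Qm horner0 mulf_eq0 (negPf q0) orbF -[P`_m]/(lead_coef P).
    by rewrite lead_coef_eq0 (negPf P0).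
  set k := (size (Q m)).-1.
  have kQ : (k < size (Q m))%N by rewrite /k prednK // size_poly_gt0.
  apply/eqP => /polyP/(_ k); rewrite coef_poly (leq_trans kQ (sQ _ md)) coef0.
  apply/eqP/Rx/eqP => /polyP/(_ m); rewrite coef_poly md coef0.
  by apply/eqP; rewrite -/(lead_coef _) lead_coef_eq0.
(* The roles are exchanged: [x] is algebraic over [S], and [W], with coefficients in S[x],
   annihilates [a], which would make [a] algebraic over [S]. *)
case: (aT (f * N)%N); apply: (@degree_le_tower _ S f N x a W) => //.
  exact: leq_trans (size_poly _ _) _.
move=> k; rewrite coef_poly; case: ifP => _; first by exists (R k).
by exists 0; rewrite rpred0 horner0.
Qed.

(** For algebraic [a] the denominators can be inverted within S[a], so the tower bound applies. *)
Lemma degree_le_adjoin_algebraic (C : fieldType) (S : divringClosed C) (d e : nat)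
    (a x : C) :
  degree_le S e a -> degree_le (adjoin S a) d x -> degree_le S (e * d) x.
Proof.
move=> ha [P [PS P0 sP Px]]; apply: (degree_le_tower (ha) P0 sP Px) => j.
have /asboolP[p [q [pS qS q0 Ej]]] := polyOverP PS j.
have hq : degree_le S (e * 1) q.[a].
  apply: (@degree_le_tower _ S e 1 a _ ('X - q.[a]%:P)) => //.
  - by rewrite polyXsubC_eq0.
  - by rewrite size_XsubC.
  - by rewrite root_XsubC.
  move=> k; exists ((k == 1%N)%:R - if k == 0%N then q else 0); split.
    by rewrite rpredB ?rpred_nat //; case: ifP; rewrite ?rpred0.
  rewrite coefB coefX coefC hornerD hornerN hornerMn hornerC.
  by case: ifP => _; rewrite ?horner0.
have [r rS Er] := algebraic_inv_horner hq.
exists (p * (r \Po q)); split; first by rewrite rpredM // polyOver_comp.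
by rewrite Ej hornerM horner_comp Er.
Qed.

Lemma degree_leS (C : fieldType) (S S' : {pred C}) (d : nat) (x : C) :
  {subset S <= S'} -> degree_le S d x -> degree_le S' d x.
Proof. by move=> sub [p [pS ? ? ?]]; exists p; split=> //; apply: polyOverS pS. Qed.

(** The bound [e] depends on [d] but not on [x] or [f]. Algebraicity of [x] over [S] is assumed
    because a transcendental generator has degree 1 over [S']. *)
Lemma bounded_degree_finitely_generated (C : fieldType) (S : divringClosed C)
    (s : seq C) :
  exists S' : divringClosed C, [/\ {subset S <= S'}, {subset s <= S'} &
    forall d, exists e, forall f x,
      degree_le S f x -> degree_le S' d x -> degree_le S e x].
Proof.
elim: s => [|a s [S1 [sub1 s1 bound1]]].
  by exists S; split=> // d; exists d.
exists (GRing.DivringClosed.clone C (adjoin S1 a) _); split.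
- by move=> x /sub1; apply: sub_adjoin.
- move=> x; rewrite inE => /predU1P[->|/s1]; first exact: mem_adjoin.
  exact: sub_adjoin.
move=> d; have [[e0 ae]|aT] := pselect (exists e, degree_le S1 e a).
  have [e eP] := bound1 (e0 * d)%N; exists e => f x xf.
  by move=> /(degree_le_adjoin_algebraic ae); apply: (eP f).
have [e eP] := bound1 d; exists e => f x xf xd; apply: (eP f) => //.
apply: degree_le_transcendental xd; last exact: degree_leS xf.
by move=> e' ae; apply: aT; exists e'.
Qed.

(** * Orders of roots of unity of bounded degree *)

(** If p^k exactly divides n, then phi(p^k) divides phi(n), and p^k = p^(k-1) + phi(p^k) is at most
    2 phi(p^k), hence at most 2e. So each prime power of n divides (2e)!. *)
Lemma dvdn_fact_totient (n e : nat) : (0 < n)%N -> (totient n <= e)%N ->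
  (n %| (e.*2)`!)%N.
Proof.
move=> n0 ne; apply/dvdn_partP => // p; rewrite mem_primes => /and3P[pp _ pn].
have l0 : (0 < logn p n)%N by rewrite logn_gt0 mem_primes pp n0.
have t0 : (0 < totient n)%N by rewrite totient_gt0.
apply: dvdn_fact; rewrite part_gt0 /=.
have h : (totient n`_p <= e)%N.
  apply: leq_trans ne; apply: dvdn_leq => //.
  by rewrite -{2}(partnC p n0) totient_coprime ?dvdn_mulr ?coprime_partC.
rewrite -addnn; move: h; rewrite p_part totient_pfactor // => h.
have -> : (p ^ logn p n = p ^ (logn p n).-1 + p.-1 * p ^ (logn p n).-1)%N.
  by rewrite -mulSn prednK ?prime_gt0 // -expnS prednK.
apply: leq_add => //; apply: leq_trans h.
by rewrite leq_pmull // -ltnS prednK ?prime_gt0 // prime_gt1.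
Qed.

(** X^n - 1 is the product of the Phi_d for d dividing n, so [z] is a root of some Phi_d; then z^d =
    1 forces n to divide d. *)
Lemma root_Cyclotomic (C : numFieldType) (n : nat) (z : C) :
  n.-primitive_root z -> root (map_poly intr 'Phi_n) z.
Proof.
move=> zn; have n0 := prim_order_gt0 zn.
have E d : (0 < d)%N ->
    \prod_(k <- divisors d) map_poly intr 'Phi_k = 'X^d - 1 :> {poly C}.
  by move=> d0; rewrite -rmorph_prod prod_Cyclotomic // rmorphB /= map_polyXn rmorph1.
have : root (\prod_(k <- divisors n) map_poly intr 'Phi_k) z.
  by rewrite E // rootE !hornerE prim_expr_order // subrr.
rewrite -(big_map (fun k => map_poly intr 'Phi_k) xpredT id) -[root _ _]negbK.
rewrite root_bigmul all_map => /allPn[d]; rewrite -dvdn_divisors // negbK => dn zd.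
suff <- : d = n by [].
have d0 := dvdn_gt0 n0 dn.
have : root ('X^d - 1) z.
  rewrite -E // (big_rem d) -?dvdn_divisors //=.
  by rewrite rootM zd.
rewrite rootE !hornerE subr_eq0 -(prim_order_dvd zn) => nd.
by apply/eqP; rewrite eqn_dvd dn.
Qed.

(** Irreducibility of Phi_n is imported from [algC]. The gcd with [p], computed over the rationals,
    is nonconstant because of [z], so it has a root [w] in [algC], a primitive n-th root of unity
    with minimal polynomial Phi_n. *)
Lemma totient_lt_size (C : numClosedFieldType) (n : nat) (z : C) (p : {poly rat}) :
  n.-primitive_root z -> p != 0 -> root (map_poly ratr p) z ->
  (totient n < size p)%N.
Proof.
move=> zn p0 pz; have n0 := prim_order_gt0 zn.
pose P : {poly rat} := map_poly intr 'Phi_n.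
have PE (K : numFieldType) : map_poly ratr P = map_poly intr 'Phi_n :> {poly K}.
  by rewrite -map_poly_comp; apply: eq_map_poly => k; rewrite /= ratr_int.
have sP : size P = (totient n).+1.
  by rewrite size_map_poly_id0 ?size_Cyclotomic // intr_eq0 (monicP (Cyclotomic_monic n)).
have [w gw] : exists w : algC, root (map_poly ratr (gcdp P p)) w.
  apply: closed_rootP; rewrite size_map_poly; apply: contraTneq isT => /eqP g1.
  have : root (map_poly ratr (gcdp P p)) z.
    by rewrite gcdp_map root_gcd pz PE root_Cyclotomic.
  have /size_poly1P[c c0 ->] := g1.
  by rewrite map_polyC rootC fmorph_eq0 (negPf c0).
move: gw; rewrite gcdp_map root_gcd PE => /andP[wP wp].
have [u un] := C_prim_root_exists n0.
have wn : n.-primitive_root w.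
  by rewrite -(root_cyclotomic un) -(Cintr_Cyclotomic un).
have [m [mE mm md]] := minCpolyP w.
have Em : m = P.
  apply: (map_poly_inj (@ratr algC)).
  by rewrite -mE (minCpoly_cyclotomic wn) -(Cintr_Cyclotomic wn) PE.
by rewrite -sP -Em; apply: dvdp_leq => //; rewrite -md.
Qed.

Definition prime_subfield (C : numFieldType) : {pred C} :=
  fun x => `[< exists q : rat, x = ratr q >].

Lemma prime_subfield_divring_closed (C : numFieldType) :
  GRing.divring_closed (@prime_subfield C).
Proof.
split; first by apply/asboolP; exists 1; rewrite rmorph1.
- move=> _ _ /asboolP[x ->] /asboolP[y ->].
  by apply/asboolP; exists (x - y); rewrite rmorphB.
- move=> _ _ /asboolP[x ->] /asboolP[y ->].
  by apply/asboolP; exists (x / y); rewrite fmorph_div.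
Qed.

HB.instance Definition _ (C : numFieldType) :=
  GRing.isDivringClosed.Build C (@prime_subfield C)
    (prime_subfield_divring_closed C).

Lemma unity_root_degree_le (C : numClosedFieldType) (n e : nat) (z : C) :
  (0 < n)%N -> z ^+ n = 1 -> degree_le (@prime_subfield C) e z ->
  z ^+ (e.*2)`! = 1.
Proof.
move=> n0 zn [p [pS p0 sp pz]].
have [m mz _] := prim_order_exists n0 zn.
have /choice[c cE] : forall i, exists q : rat, p`_i = ratr q.
  by move=> i; apply/asboolP/(polyOverP pS).
pose q := \poly_(i < size p) c i.
have qE : map_poly ratr q = p.
  apply/polyP => i; rewrite coef_map coef_poly /=; case: ltnP => [_|pi].
    by rewrite cE.
  by rewrite rmorph0 nth_default.
have q0 : q != 0 by apply: contraNneq p0 => q0; rewrite -qE q0 rmorph0.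
have : (totient m < size q)%N by apply: totient_lt_size mz q0 _; rewrite qE.
move=> /leq_trans/(_ (leq_trans (size_poly _ _) sp)).
rewrite ltnS => /(dvdn_fact_totient (prim_order_gt0 mz)).
by rewrite (prim_order_dvd mz) => /eqP.
Qed.

Lemma bounded_degree_unity_roots (C : numClosedFieldType) (s : seq C) :
  exists2 S : divringClosed C, {subset s <= S} &
    forall d, exists2 m, (0 < m)%N & forall n z,
      (0 < n)%N -> z ^+ n = 1 -> degree_le S d z -> z ^+ m = 1.
Proof.
have [S [_ sS bound]] := @bounded_degree_finitely_generated C
  (GRing.DivringClosed.clone C (@prime_subfield C) _) s.
exists S => // d; have [e eP] := bound d.
exists (e.*2)`!; first exact: fact_gt0.
move=> n z n0 zn zd; apply: (unity_root_degree_le n0 zn).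
(* X^n - 1 shows that [z] is algebraic over the rationals; its degree n does not affect the bound
   [e]. *)
apply: (eP n) zd; exists ('X^n - 1); split.
- by rewrite rpredB ?polyOverXn ?rpred1.
- by rewrite -size_poly_gt0 size_XnsubC.
- by rewrite size_XnsubC.
- by rewrite rootE !hornerE zn subrr.
Qed.

(** * Equations of axes and the angle between them *)

(* The fixed points of M are the roots of M10 X^2 + (M11 - M00) X - M01. *)
Lemma mobius_bd_fixed (R : realType) (M : 'M[R]_2) (a : R) :
  mobius_bd M (Some a) = Some a -> M 1 0 * a ^+ 2 + (M 1 1 - M 0 0) * a - M 0 1 = 0.
Proof.
rewrite /mobius_bd; case: eqP => // /eqP h [E].
have {}E : M 0 0 * a + M 0 1 = a * (M 1 0 * a + M 1 1) by exact: (canRL (divfK h) E).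
by move: E; lra.
Qed.

(** By Vieta, the fixed-point quadratic determines the sum and product of the endpoints a, b, which
    are the coefficients in the equation of the circle with diameter [a, b]. A vertical axis has M10
    = 0. *)
Lemma axis_equation (R : realType) (M : 'M[R]_2) (z : R[i]%C) : axis M z ->
  M 1 0 * (complex.Re z ^+ 2 + complex.Im z ^+ 2)
    + (M 1 1 - M 0 0) * complex.Re z - M 0 1 = 0.
Proof.
move=> [x [y [xy Mx My [_]]]].
have vertical (a : R) : mobius_bd M None = None -> mobius_bd M (Some a) = Some a ->
    complex.Re z = a -> M 1 0 * (complex.Re z ^+ 2 + complex.Im z ^+ 2)
      + (M 1 1 - M 0 0) * complex.Re z - M 0 1 = 0.
  move=> /= + /mobius_bd_fixed Ma ->; case: eqP => // M10 _.
  by move: Ma; rewrite M10 !mul0r.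
case: x y xy Mx My => [a|] [b|] //= xy Mx My; [|exact: vertical|exact: vertical].
move=> /(congr1 (fun w => w ^+ 2)); rewrite -add_Re2_Im2 -rmorphXn /= => -[E].
have {}E : complex.Re z ^+ 2 + complex.Im z ^+ 2 - (a + b) * complex.Re z + a * b = 0.
  move: E; rewrite expr_div_n real_normK ?num_real //; case: (z) => zr zi /=; lra.
have Ma := mobius_bd_fixed Mx; have Mb := mobius_bd_fixed My.
have ab : a - b != 0 by rewrite subr_eq0; apply: contraNneq xy => ->.
have h1 : M 1 1 - M 0 0 = - M 1 0 * (a + b).
  apply: (mulIf ab); lra.
have h2 : M 0 1 = - M 1 0 * (a * b) by move: Ma; rewrite h1; lra.
rewrite h1 h2; transitivity (M 1 0 * (complex.Re z ^+ 2 + complex.Im z ^+ 2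
  - (a + b) * complex.Re z + a * b)); first by ring.
by rewrite E mulr0.
Qed.

(** Differentiates the axis equation along a curve in the axis. *)
Lemma axis_tangent (R : realType) (M : 'M[R]_2) (z u : R[i]%C) :
  tangent (axis M) z u ->
  (M 1 0 * complex.Re z *+ 2 + (M 1 1 - M 0 0)) * complex.Re u
    + (M 1 0 * complex.Im z *+ 2) * complex.Im u = 0.
Proof.
move=> [_ [c [cM c0 dx dy]]].
set x := fun t => complex.Re (c t) in dx; set y := fun t => complex.Im (c t) in dy.
pose F := M 1 0 \*: (x * x + y * y) + (M 1 1 - M 0 0) \*: x - cst (M 0 1).
have F0 : F = cst 0.
  apply/funext => t; rewrite -[RHS](axis_equation (cM t)) /F /x /y.
  by rewrite !fctE /= !expr2.
have : 'D_1 F 0 = 0 by rewrite F0 derive_val.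
rewrite /F derive_val /x /y c0 => <-.
by rewrite /GRing.scale /=; ring.
Qed.

Lemma det_mx22 (R : comNzRingType) (M : 'M[R]_2) :
  \det M = M 0 0 * M 1 1 - M 0 1 * M 1 0.
Proof.
rewrite (expand_det_row _ 0) !big_ord_recl big_ord0 addr0 /cofactor !det_mx11 !mxE.
have E1 : lift ord0 ord0 = 1 :> 'I_2 by apply/val_inj.
have E0 : lift (1 : 'I_2) ord0 = 0 by apply/val_inj.
by rewrite ?E1 ?E0 /= expr0 expr1 mul1r mulN1r mulrN.
Qed.

(** The axes meet at the same angle as their normals, and squaring removes the sign ambiguity.
    Modulo the axis equations, the norms and scalar product of the normals no longer involve [z]. *)
Lemma cos_sqr_angle (R : realType) (M N : 'M[R]_2) (z : R[i]%C) (theta : R) :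
  \det M = 1 -> \det N = 1 -> axis M z -> axis N z ->
  ccw_angle (axis M) (axis N) z theta ->
  cos theta ^+ 2 * ((\tr M ^+ 2 - 4) * (\tr N ^+ 2 - 4)) =
  ((M 1 1 - M 0 0) * (N 1 1 - N 0 0) + (M 0 1 * N 1 0 + M 1 0 * N 0 1) *+ 2) ^+ 2.
Proof.
move=> dM dN zM zN [_ [u [uM uN]]].
have := axis_tangent uM; have := axis_tangent uN.
have := axis_equation zM; have := axis_equation zN.
have [u0 _] := uM.
have := cos2Dsin2 theta.
move: dM dN; rewrite !det_mx22 /mxtrace !big_ord_recl !big_ord0 !addr0.
have -> : lift ord0 ord0 = 1 :> 'I_2 by apply/val_inj.
move: u0; case: z {zM zN uM uN} => X Y; case: u => a b; rewrite eq_complex negb_and /=.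
move: (M 0 0) (M 0 1) (M 1 0) (M 1 1) => m n g d.
move: (N 0 0) (N 0 1) (N 1 0) (N 1 1) => m' n' g' d'.
move: (cos theta) (sin theta) => c s u0 dM dN cs zN zM uN uM.
(* (p, q) and (p', q') are the normals to the axes at z, of squared norms
   tr^2 - 4. *)
have {}cs : s ^+ 2 = 1 - c ^+ 2 by rewrite -cs; ring.
set p := g * X *+ 2 + (d - m) in uM; set q := g * Y *+ 2 in uM.
set p' := g' * X *+ 2 + (d' - m') in uN; set q' := g' * Y *+ 2 in uN.
have D (k l i j : R) : k * j - l * i = 1 ->
    i * (X ^+ 2 + Y ^+ 2) + (j - k) * X - l = 0 ->
    (k + j) ^+ 2 - 4 = (i * X *+ 2 + (j - k)) ^+ 2 + (i * Y *+ 2) ^+ 2.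
  move=> det1 z0; transitivity ((i * X *+ 2 + (j - k)) ^+ 2 + (i * Y *+ 2) ^+ 2
    + 4 * (k * j - l * i - 1) - 4 * i * (i * (X ^+ 2 + Y ^+ 2) + (j - k) * X - l)).
    by ring.
  by rewrite det1 z0; ring.
have B : (d - m) * (d' - m') + (n * g' + g * n') *+ 2 = p * p' + q * q'.
  transitivity (p * p' + q * q' - 2 * g' * (g * (X ^+ 2 + Y ^+ 2) + (d - m) * X - n)
    - 2 * g * (g' * (X ^+ 2 + Y ^+ 2) + (d' - m') * X - n')).
    by rewrite /p /p' /q /q'; ring.
  by rewrite zM zN; ring.
rewrite (D _ _ _ _ dM zM) (D _ _ _ _ dN zN) -/p -/q -/p' -/q' B.
(* [u] is orthogonal to (p, q) and its rotation to (p', q'); [u] is eliminated by cancelling a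
   nonzero coordinate. *)
have W : s * (p * p' + q * q') = c * (p * q' - p' * q).
  case/orP: u0 => [a0|b0].
    apply: (mulfI a0); transitivity (a * (c * (p * q' - p' * q))
      + q * (p' * (c * a - s * b) + q' * (c * b + s * a))
      - (c * q' - s * p') * (p * a + q * b)); first by ring.
    by rewrite uM uN; ring.
  apply: (mulfI b0); transitivity (b * (c * (p * q' - p' * q))
    - p * (p' * (c * a - s * b) + q' * (c * b + s * a))
    + (c * p' + s * q') * (p * a + q * b)); first by ring.
  by rewrite uM uN; ring.
(* Lagrange's identity: the product of the squared norms is the squared scalar product plus the
   squared determinant. *)
transitivity (c ^+ 2 * (p * p' + q * q') ^+ 2 + (c * (p * q' - p' * q)) ^+ 2).
  by ring.
by rewrite -W exprMn cs; ring.
Qed.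

(** * The field of matrix entries, and rational angles *)

(** Serves as the test subgroup in [finitely_generated]: once [S] contains the entries of the
    generators, it contains those of the whole group. *)
Lemma psl2_subgroup_entries (R : realType) (S : divringClosed R[i]%C) :
  psl2_subgroup [set M : 'M[R]_2 | \det M = 1 /\ forall i j, (M i j)%:C%C \in S].
Proof.
split=> [M []//||M [d1 MS]|M N [dM MS] [dN NS]|M [d1 MS]] /=.
- split=> [|i j]; first exact: det1.
  by rewrite !mxE; case: (i == j); rewrite ?rpred1 ?rpred0.
- split=> [|i j]; last by rewrite mxE rmorphN /= rpredN.
  by rewrite -scaleN1r detZ d1 mulr1 sqrrN expr1n.
- split=> [|i j]; first by rewrite det_mulmx dM dN mulr1.
  rewrite mxE rmorph_sum; apply: rpred_sum => k _.
  by rewrite rmorphM; apply: rpredM; [apply: MS|apply: NS].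
have uM : M \in unitmx by rewrite unitmxE d1 unitr1.
split=> [|i j]; first by rewrite det_inv d1 invr1.
rewrite /invmx uM d1 invr1 scale1r !mxE /cofactor rmorphM rmorphXn rmorphN rmorph1.
apply: rpredM; first by rewrite rpredX // rpredN rpred1.
rewrite -det_map_mx; apply: rpred_det => k l; rewrite !mxE; exact: MS.
Qed.

Lemma expi_mulrn (R : realType) (x : R) (n : nat) :
  (cos x +i* sin x)%C ^+ n = (cos (x *+ n) +i* sin (x *+ n))%C.
Proof.
elim: n => [|n IH]; first by rewrite expr0 !mulr0n cos0 sin0.
by rewrite exprS IH mulrS cosD sinD; apply/eqP; rewrite eq_complex /=;
  apply/andP; split; apply/eqP; ring.
Qed.

Lemma expi_2pi (R : realType) (n : nat) :
  (cos (pi *+ 2 *+ n) +i* sin (pi *+ 2 *+ n))%C = 1 :> R[i]%C.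
Proof. by rewrite -expi_mulrn cos2pi sin2pi expr1n. Qed.

(** Equality gives cos(2(y - x)) = 1, so sin(y - x) = 0, which is impossible for 0 < y - x < pi. *)
Lemma expi_double_inj (R : realType) (x y : R) : 0 < x < pi -> 0 < y < pi ->
  (cos (x *+ 2) +i* sin (x *+ 2))%C = (cos (y *+ 2) +i* sin (y *+ 2))%C -> x = y.
Proof.
wlog xy : x y / x <= y.
  move=> h hx hy e; case: (leP x y) => [|/ltW] xy; first exact: h.
  by apply/esym; apply: h.
move=> /andP[x0 xpi] /andP[y0 ypi] [ec es].
have : cos ((y - x) *+ 2) = 1.
  by rewrite mulrnBl cosB ec es -!expr2 cos2Dsin2.
rewrite cos_mulr2n cos2sin2 => h; have s0 : sin (y - x) = 0.
  by apply/eqP; rewrite -sqrf_eq0; apply/eqP; lra.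
move: xy; rewrite le_eqVlt => /predU1P[//|xy].
have : 0 < sin (y - x) by apply: sin_gt0_pi; apply/andP; split; lra.
by rewrite s0 ltxx.
Qed.

(** The exponent is the denominator of q; positivity makes the numerator a natural number of full
    turns. *)
Lemma rational_angle_unity_root (R : realType) (q : rat) :
  0 < ratr q * pi :> R ->
  exists2 n, (0 < n)%N &
    (cos (ratr q * pi *+ 2) +i* sin (ratr q * pi *+ 2))%C ^+ n = 1 :> R[i]%C.
Proof.
rewrite pmulr_lgt0 ?pi_gt0 // ltr0q => q0.
exists `|denq q|%N; first by rewrite absz_gt0 denq_neq0.
suff E : (ratr q * pi) *+ 2 *+ `|denq q| = pi *+ 2 *+ `|numq q| :> R.
  by rewrite expi_mulrn E expi_2pi.
have d0 : (denq q)%:~R != 0 :> R by rewrite intr_eq0 denq_neq0.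
rewrite -[LHS]mulr_natr -[RHS]mulr_natr !natr_absz !gtr0_norm ?denq_gt0 ?numq_gt0 //.
by rewrite /ratr; field.
Qed.

(** cos 2t = 2 cos^2 t - 1, and hyperbolicity keeps the denominator of cos^2 t away from zero. *)
Lemma cos_double_mem (R : realType) (S : divringClosed R[i]%C) (M N : 'M[R]_2)
    (z : R[i]%C) (theta : R) :
  (forall i j, (M i j)%:C%C \in S) -> (forall i j, (N i j)%:C%C \in S) ->
  \det M = 1 -> \det N = 1 -> hyperbolic M -> hyperbolic N ->
  axis M z -> axis N z -> ccw_angle (axis M) (axis N) z theta ->
  (cos (theta *+ 2))%:C%C \in S.
Proof.
move=> MS NS dM dN hM hN zM zN /(cos_sqr_angle dM dN zM zN).
have D0 (P : 'M[R]_2) : hyperbolic P -> \tr P ^+ 2 - 4 != 0.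
  rewrite /hyperbolic => hP; rewrite gt_eqF // subr_gt0 -real_normK ?num_real //.
  have -> : (4 : R) = 2 ^+ 2 by ring.
  by rewrite ltr_pXn2r ?nnegrE.
have trS (P : 'M[R]_2) : (forall i j, (P i j)%:C%C \in S) -> (\tr P)%:C%C \in S.
  by move=> PS; rewrite rmorph_sum; apply: rpred_sum => i _; apply: PS.
have DS (P : 'M[R]_2) : (forall i j, (P i j)%:C%C \in S) ->
    (\tr P ^+ 2 - 4)%:C%C \in S.
  move=> /trS PS; rewrite rmorphB rmorphXn rmorph_nat.
  by apply: rpredB; [apply: rpredX|apply: rpred_nat].
have DD0 := mulf_neq0 (D0 M hM) (D0 N hN).
move=> /(canRL (mulfK DD0)) cE.
rewrite cos_mulr2n cE rmorphB rmorph1 rmorphMn; apply: rpredB; last exact: rpred1.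
apply: rpredMn; rewrite fmorph_div [X in _ / X]rmorphM.
apply: rpred_div; last by apply: rpredM; apply: DS.
rewrite rmorphXn; apply: rpredX.
rewrite rmorphD rmorphMn rmorphM 2!rmorphB rmorphD 2!rmorphM.
by apply: rpredD; [|apply: rpredMn; apply: rpredD]; apply: rpredM;
  first [apply: rpredB|idtac]; first [apply: MS|apply: NS].
Qed.

Theorem theorem1p3 (R : realType) (G : set 'M[R]_2)
    (hG : fuchsian G) (fgG : finitely_generated G) :
  finite_set (angle_set G `&` [set ratr q * pi | q in [set: rat]]).
Proof.
have [[detG _ _ _ _] _] := hG; have [gens [gensG genG]] := fgG.
pose s := [seq (M ij.1 ij.2)%:C%C | M : 'M[R]_2 <- gens,
  ij : 'I_2 * 'I_2 <- enum {: 'I_2 * 'I_2}].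
have [S sS bound] := bounded_degree_unity_roots s.
have GS M : G M -> forall i j, (M i j)%:C%C \in S.
  move=> GM; suff [] : [set M : 'M[R]_2 | \det M = 1 /\
    forall i j, (M i j)%:C%C \in S] M by [].
  apply: genG GM; first exact: psl2_subgroup_entries.
  move=> P /= Pg; split=> [|i j]; first exact/detG/gensG.
  by apply: sS; apply/allpairsP; exists (P, (i, j)); split=> //=; rewrite mem_enum.
have [m m0 mP] := bound 2%N.
(* The angle is doubled because it is cos 2t that is known to lie in [S]. *)
pose e (t : R) : R[i]%C := (cos (t *+ 2) +i* sin (t *+ 2))%C.
pose T := angle_set G `&` [set ratr q * pi | q in [set: rat]].
have Tpi t : T t -> 0 < t < pi.
  by move=> [[g [d [p [_ _ _ _ [M [N [z [_ _ _ _ []]]]]]]]]].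
have Te : e @` T `<=` [set z | z ^+ m = 1].
  move=> _ [t Tt <-]; have := Tpi t Tt => /andP[t0 _].
  have [[g [d [p [_ _ _ _ [M [N [z [[GM hM _] [GN hN _] _ [zM zN] tMN]]]]]]]]] := Tt.
  move=> [q _ Et].
  have [n n0 tn] : exists2 n, (0 < n)%N & e t ^+ n = 1.
    by rewrite -Et; apply: rational_angle_unity_root; rewrite Et.
  apply: (mP n) => //.
  have cS := cos_double_mem (GS M GM) (GS N GN) (detG M GM) (detG N GN)
    hM hN zM zN tMN.
  (* The roots of this polynomial are [e t] and its conjugate, whence the degree 2 passed to
     [bound]. *)
  exists ('X^2 - ((cos (t *+ 2))%:C%C *+ 2) *: 'X + 1).
  have sz : size ('X^2 - ((cos (t *+ 2))%:C%C *+ 2) *: 'X + 1 : {poly R[i]%C}) = 3%N.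
    rewrite -addrA size_polyDl size_polyXn //.
    apply: leq_ltn_trans (size_polyD _ _) _.
    rewrite gtn_max size_polyN size_poly1 andbT ltnS.
    by apply: leq_trans (size_scale_leq _ _) _; rewrite size_polyX.
  split; [|by rewrite -size_poly_gt0 sz|by rewrite sz|].
    by rewrite rpredD ?rpred1 // rpredB ?polyOverXn // polyOverZ ?polyOverX // rpredMn.
  apply/rootP; rewrite !hornerE.
  have := cos2Dsin2 (t *+ 2); rewrite /e; move: (cos _) (sin _) => x y xy.
  apply/eqP; rewrite eq_complex /=; apply/andP; split; apply/eqP; last by ring.
  by transitivity (1 - (x ^+ 2 + y ^+ 2)); [ring|rewrite xy subrr].
have finU : finite_set [set z : R[i]%C | z ^+ m = 1].
  have [r rE] := closed_field_poly_normal ('X^m - 1 : {poly R[i]%C}).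
  apply: (@sub_finite_set _ _ [set` r]); last exact: finite_seq.
  move=> z /= zm; rewrite -root_prod_XsubC.
  have := rE; rewrite (monicP (monicXnsubC 1 m0)) scale1r => <-.
  by rewrite rootE !hornerE zm subrr.
have {finU} finE := sub_finite_set Te finU.
(* Injectivity of [e] on [T] carries finiteness back from the m-th roots of unity to the angles. *)
rewrite -(eq_finite_set (inj_card_eq (f := e) _)) // => t t'.
rewrite !inE => /Tpi ht /Tpi ht'; exact: expi_double_inj.
Qed.
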